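(* Suppose that the support $\mathcal S=\{a\in\mathcal A:p_a>0\}$ is infinite. Assume that $\kappa_+^0\in(1,2]$ and that, for some $\alpha\in[0,1]$ and some function $\ell$ slowly varying at $+\infty$, we have $\nu(\varepsilon)\le \varepsilon^{-\alpha}\ell(1/\varepsilon)$ for all $0<\varepsilon\le1$. Then, for all integers $n\ge 2$ large enough so that $$\kappa_+\left(\frac2n\right)\le2\kappa_+^0-1,$$ all integers $0\le r\le n-1$ and all $\beta\in(0,1)$ with $\beta>2(\alpha-r)-1$, $$\mathbb E M_{n,r}\le c(r)\,n^{\alpha-1}\ell(n)+(\kappa_+^0-1)\,c_2(\alpha,\beta,r)\left(\frac n2\right)^{\alpha-\frac{1+\beta}{2}}\ell^{\circ}_{\beta}\left(\frac n2\right),$$ where $$c_2(\alpha,\beta,r)=\frac{4^{1+r}}{r!}\left(\frac{1+r}{2}\right)^{\frac{1+\beta}{2}+r-\alpha}\sqrt{\gamma(1+\beta+2(r-\alpha),1)} .$$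
   Context: $\mathcal A$ is an at most countable set and $P=\{p_a:a\in\mathcal A\}$ is a probability distribution on $\mathcal A$ ($p_a\in[0,1]$, $\sum_{a}p_a=1$). $X_1,\dots,X_n$ are i.i.d. $\mathcal A$-valued random variables with distribution $P$; $\xi_n(a)=\sum_{i=1}^n\mathbf 1\{X_i=a\}$. For $0\le r\le n$, $M_{n,r}=\sum_{a\in\mathcal A}p_a\mathbf 1\{\xi_n(a)=r\}$. The counting function of $P$ is $\nu(\varepsilon)=|\{a\in\mathcal A:p_a\ge\varepsilon\}|$. For $\varepsilon\in(0,1]$, $\kappa_+(\varepsilon)=\sup_{0<u\le\varepsilon}\nu(u/2)/\nu(u)\in[1,+\infty]$, where a ratio with denominator $\nu(u)=0$ is interpreted as $+\infty$; $\kappa_+$ is non-decreasing and $\kappa_+^0=\lim_{\varepsilon\to0}\kappa_+(\varepsilon)$. A (measurable) function $\ell:[0,+\infty)\to\mathbb R$ is slowly varying at $+\infty$ if $\ell(cx)/\ell(x)\to1$ as $x\to+\infty$ for every $c>0$. For $\beta\in(0,1)$ and $x\ge1$, $$\ell^{\circ}_\beta(x)=\sqrt{\int_{2x}^{+\infty}\frac{\ell(u)^2}{u^{2-\beta}}\,\mathrm du}.$$ The constant $c(r)$ is $c(0)=e^{-1}$ and $c(r)=e(1+r)/\sqrt{\pi}$ for $r\ge 1$. The lower incomplete Gamma function is $\gamma(t,x)=\int_0^x u^{t-1}e^{-u}\,\mathrm du$ for $t>0$, $x\ge0$. *)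

(* Defs.v *)
From HB Require Import structures.
From mathcomp Require Import all_boot all_order all_algebra.
From mathcomp Require Import all_classical all_reals all_analysis.

Set Implicit Arguments.
Unset Strict Implicit.
Unset Printing Implicit Defensive.

Import Order.TTheory GRing.Theory Num.Theory.
Import numFieldNormedType.Exports.

Local Open Scope classical_set_scope.
Local Open Scope ring_scope.

Section distribution.
Context {R : realType} {A : countType}.
Implicit Types (p : A -> R) (eps : R).

Definition is_distribution p : Prop :=
  (forall a, 0 <= p a <= 1) /\
  (\esum_(a in [set: A]) (p a)%:E = 1)%E.

Definition support_of p : set A := [set a | 0 < p a].

Definition nu p eps : \bar R := counting [set a | eps <= p a].

(* The test on the denominator is needed: in [\bar R], [0 / 0] is [0]. *)
Definition nu_ratio p (u : R) : \bar R :=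
  (if nu p u == 0 then +oo else nu p (u / 2)%R / nu p u)%E.

Definition kappa p eps : \bar R :=
  ereal_sup [set nu_ratio p u | u in [set u : R | 0 < u <= eps]].

Definition kappa0 p : \bar R := lim (kappa p eps @[eps --> 0^'+]).

End distribution.

Section sample.
Context {R : realType} {A : countType} {d : measure_display}
  {T : measurableType d}.

(* [A] carries the discrete sigma-algebra, so every subset of [A] is an event
   and the law of a variable is determined by its values on singletons. *)
Record iid_sample (P : probability T R) (p : A -> R) (n : nat)
    (X : 'I_n -> T -> A) : Prop := {
  iid_measurable : forall i (B : set A), measurable (X i @^-1` B) ;
  iid_law : forall i a, P (X i @^-1` [set a]) = (p a)%:E ;
  iid_independent : forall (J : {set 'I_n}) (B : 'I_n -> set A),
    P (\bigcap_(i in [set` J]) (X i @^-1` B i)) =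
    (\prod_(i in J) P (X i @^-1` B i))%E }.

Definition xi (n : nat) (X : 'I_n -> T -> A) (a : A) (w : T) : nat :=
  (\sum_(i < n) (X i w == a))%N.

(* The sum lies in [0, 1] when [p] is a distribution, so [fine] loses nothing. *)
Definition occupancy_mass (p : A -> R) (n : nat) (X : 'I_n -> T -> A)
    (r : nat) (w : T) : R :=
  fine (\esum_(a in [set: A]) (p a * (xi X a w == r)%:R)%:E)%E.

End sample.

Section constants.
Context {R : realType}.
Implicit Types (ell : R -> R) (alpha beta x t : R) (r : nat).

(* Functions on [0, +oo) are represented by total functions on [R], whose
   values at negative arguments are never used. *)
Definition slowly_varying ell : Prop :=
  measurable_fun (`[0, +oo[ : set R) ell /\
  forall c, 0 < c -> (ell (c * x) / ell x) @[x --> +oo] --> (1 : R).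

(* Extended-real valued: a slowly varying function need not be locally
   square-integrable, in which case the integral is [+oo]. *)
Definition ell_circ ell beta x : \bar R :=
  sqrte (\int[lebesgue_measure]_(u in `[(2 * x)%R, +oo[)
    (ell u ^+ 2 / u `^ (2 - beta))%:E)%E.

Definition lower_gamma t x : R :=
  \int[lebesgue_measure]_(u in `[0, x]) (u `^ (t - 1) * expR (- u)).

Definition c_const r : R :=
  if r == 0%N then expR (-1) else expR 1 * r.+1%:R / Num.sqrt pi.

Definition c2_const alpha beta r : R :=
  4 ^+ r.+1 / r`!%:R *
  (r.+1%:R / 2) `^ ((1 + beta) / 2 + r%:R - alpha) *
  Num.sqrt (lower_gamma (1 + beta + 2 * (r%:R - alpha)) 1).

End constants.

(* Main.v *)
Require Import Defs.
From HB Require Import structures.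
From mathcomp Require Import all_boot all_order all_algebra.
From mathcomp Require Import all_classical all_reals all_analysis.
From mathcomp Require Import measurable_realfun ring lra.
Import Order.TTheory GRing.Theory Num.Theory.
Import numFieldNormedType.Exports.
Local Open Scope classical_set_scope.
Local Open Scope ring_scope.

Set Implicit Arguments.
Unset Strict Implicit.
Unset Printing Implicit Defensive.

(** By independence, the expected mass is
    [\sum_a 'C(n, r) p_a^(r+1) (1 - p_a)^(n-r)], and the atoms are split
    according to the size of [p_a].

    Heavy atoms, [p_a >= 1/n].  The summand is at most [c(r)/n]: it is
    [(r+1)/(n+1)] times a binomial probability, and for [r = 0] it is at most
    [p_a exp(- n p_a) <= exp(-1)/n] ([bernstein_mass_le]).  There
    are [nu(1/n) <= n^alpha ell(n)] of them, which gives the first term of the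
    bound ([heavy_sum_le]).

    Light atoms, [p_a < 1/n].  The summand is at most
    [n^r/r! p_a^(r+1) exp(- m p_a)] with [m = n/(r+1)], and this is dominated by
    an integral over [1/p_a <= w <= 2/p_a] of the weight
    [h(w) = w^-(r+2) exp(- m/(2w))] ([dyadic_weight_integral_ge]).  Summing over
    [a] and exchanging sum and integral, the number of atoms with
    [1/w <= p_a < 2/w] appears; it is [nu(1/w) - nu(2/w)], which the hypothesis
    on [kappa] bounds by [2 (kappa0 - 1) nu(1/w)] for [w >= n]
    ([dyadic_count_le]), hence by [2 (kappa0 - 1) w^alpha ell(w)].

    It remains to estimate the integral of [h(w) w^alpha ell(w)] over
    [w >= n].  Cauchy-Schwarz separates [ell(w) w^(-(2-beta)/2)], whose square
    integrates to the square of [ell_circ], from a factor whose square is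
    [w^(-t-1) exp(- m/w)] with [t = 1 + beta + 2 (r - alpha) > 0]; the
    substitution [u = m/w] turns the integral of the latter into
    [m^-t] times a piece of the integral defining [gamma(t, 1)]
    ([integral_inv_gamma_le]).

    Parametrising the scales by [w = 1/eps] instead of [eps] has the advantage
    that [ell], which is only measurable, never goes through a change of
    variables: the substitution is applied to a continuous integrand only. *)

(** * Sums over a countable type *)

Section countable_sums.
Context {R : realType} {A : countType}.

(** Numbering the countable index type gives access to the theorems on series
    of measurable functions. *)
Lemma esum_nneseries_pickle (g : A -> \bar R) : (forall a, 0 <= g a)%E ->
  (\esum_(a in [set: A]) g a = \sum_(k <oo) oapp g 0 (pickle_inv k))%E.
Proof.
move=> g0.
have o0 k : (0 <= oapp g 0 (@pickle_inv A k))%E by case: pickle_inv => //=.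
rewrite nneseries_esumT//.
transitivity (\esum_(k in range (@pickle A)) oapp g 0 (pickle_inv k))%E.
  rewrite esum_image; last by move=> x y _ _; apply: (pcan_inj pickleK).
  by apply: eq_esum => a _; rewrite pickleK_inv.
rewrite esum_mkcond; apply: eq_esum => k _; case: ifPn => //.
case E : (pickle_inv k) => [a|]//=; rewrite notin_setE => -[].
by exists a => //; have := @pickle_invK A k; rewrite E.
Qed.

Lemma ge0_integral_esum {d} {T : measurableType d}
    (mu : {measure set T -> \bar R}) (D : set T) (f : A -> T -> \bar R) :
  measurable D -> (forall a, measurable_fun D (f a)) ->
  (forall a x, 0 <= f a x)%E ->
  (\int[mu]_(x in D) (\esum_(a in [set: A]) f a x) =
   \esum_(a in [set: A]) \int[mu]_(x in D) f a x)%E.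
Proof.
move=> mD mf f0.
rewrite esum_nneseries_pickle; last by move=> a; apply: integral_ge0.
transitivity (\int[mu]_(x in D)
  \sum_(k <oo) oapp (f^~ x) 0 (@pickle_inv A k))%E.
  by apply: eq_integral => x _; rewrite esum_nneseries_pickle.
rewrite integral_nneseries//.
- by apply: eq_eseriesr => k _; case: pickle_inv => //=; rewrite integral0.
- by move=> k; case: pickle_inv => /=.
- by move=> k x _; case: pickle_inv => /=.
Qed.

Lemma measurable_fun_esum {d} {T : measurableType d} (D : set T)
    (f : A -> T -> \bar R) :
  measurable D -> (forall a, measurable_fun D (f a)) ->
  (forall a x, 0 <= f a x)%E ->
  measurable_fun D (fun x => \esum_(a in [set: A]) f a x)%E.
Proof.
move=> mD mf f0.
under eq_fun do rewrite esum_nneseries_pickle//.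
apply: ge0_emeasurable_sum => k; last by move=> _; case: pickle_inv.
by move=> x _ _; case: pickle_inv => /=.
Qed.

Lemma esumZl (c : R) (g : A -> \bar R) : 0 <= c -> (forall a, 0 <= g a)%E ->
  (\esum_(a in [set: A]) (c%:E * g a) = c%:E * \esum_(a in [set: A]) g a)%E.
Proof.
move=> c0 g0; rewrite !esum_nneseries_pickle//; last first.
  by move=> a; apply: mule_ge0.
rewrite -nneseriesZl//; last by move=> k _; case: pickle_inv => //=.
by apply: eq_eseriesr => k _; case: pickle_inv => //=; rewrite mule0.
Qed.

Lemma counting_esum (S : set A) : finite_set S ->
  counting S = (\esum_(a in [set: A]) (\1_S a)%:E)%E :> \bar R.
Proof.
move=> fS; transitivity (\esum_(a in S) (1%:E : \bar R))%E.
  rewrite esum_fset// /counting asboolT// fsbig_finite//=.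
  by rewrite sumEFin big_const_seq count_predT iter_addr_0.
rewrite esum_mkcond; apply: eq_esum => a _; rewrite indicE.
by case: (a \in S).
Qed.

End countable_sums.

(** * The binomial law of the counts *)

Section occupancy.
Context {R : realType} {A : countType} {d : measure_display}
  {T : measurableType d} (P : probability T R) (p : A -> R) (n : nat)
  (X : 'I_n -> T -> A).
Hypothesis X_iid : iid_sample P p X.

(** Fixing which draws hit [a] makes independence directly applicable: each
    draw is constrained to [a] or to its complement. *)
Lemma iid_hit_event (a : A) (J : {set 'I_n}) :
  measurable [set w | [set i | X i w == a]%SET = J] /\
  P [set w | [set i | X i w == a]%SET = J] =
  (p a ^+ #|J| * (1 - p a) ^+ (n - #|J|))%:E.
Proof.
pose B i := if i \in J then [set a] else ~` [set a].
have PB i : P (X i @^-1` B i) = (if i \in J then p a else 1 - p a)%:E.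
  rewrite /B; case: ifPn => _; first exact: (iid_law X_iid).
  rewrite -preimage_setC probability_setC; last exact: (iid_measurable X_iid).
  by rewrite (iid_law X_iid).
have -> : [set w | [set i | X i w == a]%SET = J] =
    \bigcap_(i in [set` [set: 'I_n]%SET]) (X i @^-1` B i).
  apply/seteqP; split=> [w /= wJ i _|w wB] /=.
    rewrite /B /= -wJ inE; case: eqP => //=.
  apply/setP => i; rewrite inE.
  have := wB i (finset.in_setT i); rewrite /B /=.
  case: (i \in J) => /= [->|/eqP/negbTE//].
  exact: eqxx.
split.
  apply: fin_bigcap_measurable => // i _; exact: (iid_measurable X_iid).
rewrite (iid_independent X_iid) (eq_bigr _ (fun i _ => PB i)) prodEFin.
congr EFin; rewrite (bigID (fun i => i \in J)) /=; congr (_ * _).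
  rewrite -(prodr_const (mem J)); apply: eq_big => [i|i /andP[_ ->]//].
  by rewrite inE.
have -> : (n - #|J| = #|~: J|)%N by rewrite [RHS]cardsCs finset.setCK card_ord.
rewrite -(prodr_const (mem (~: J)%SET)).
apply: eq_big => [i|i /andP[_ /negbTE ->]//].
by rewrite !inE.
Qed.

(** The event splits according to the set of draws that hit [a]; there are
    ['C(n, r)] such sets of size [r], all giving the same probability. *)
Lemma iid_count_event (a : A) (r : nat) :
  measurable [set w | xi X a w = r] /\
  P [set w | xi X a w = r] =
  ('C(n, r)%:R * p a ^+ r * (1 - p a) ^+ (n - r))%:E.
Proof.
pose E (J : {set 'I_n}) := [set w | [set i | X i w == a]%SET = J].
pose D := [set` enum [set J : {set 'I_n} | #|J| == r]%SET].
have DE J : D J -> #|J| = r by rewrite /D /= mem_enum inE => /eqP.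
have -> : [set w | xi X a w = r] = \bigcup_(J in D) E J.
  have xiE w : xi X a w = #|[set i | X i w == a]%SET|.
    rewrite /xi -sum1dep_card [RHS]big_mkcond.
    by apply: eq_bigr => i _; case: eqP.
  apply/seteqP; split=> [w /= wr|w [J /DE Jr] /= wJ]; last by rewrite xiE wJ.
  exists [set i | X i w == a]%SET => //=.
  by rewrite /D /= mem_enum inE -xiE wr.
split.
  apply: fin_bigcup_measurable => [|J _]; first exact: finite_seq.
  exact: (iid_hit_event a J).1.
rewrite measure_fin_bigcup//; last 3 first.
- exact: finite_seq.
- by move=> J K _ _ [w [<-]].
- by move=> J _; exact: (iid_hit_event a J).1.
rewrite -fsbig_seq ?enum_uniq// big_enum_cond /=.
rewrite (eq_bigr (fun=> (p a ^+ r * (1 - p a) ^+ (n - r))%:E)); last first.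
  by move=> J; rewrite inE andbT => /eqP Jr; rewrite (iid_hit_event a J).2 Jr.
rewrite sumEFin (eq_bigl (mem [set J : {set 'I_n} | #|J| == r]%SET));
  last first.
  by move=> J; rewrite andbT.
by rewrite sumr_const card_draws card_ord -mulrA mulr_natl.
Qed.

Lemma expectation_occupancy_mass (r : nat) : is_distribution p ->
  ('E_P[occupancy_mass p X r] =
   \esum_(a in [set: A])
     ('C(n, r)%:R * p a ^+ r.+1 * (1 - p a) ^+ (n - r))%:E)%E.
Proof.
move=> [p01 sp1]; have p0 a : 0 <= p a by case/andP: (p01 a).
pose F a w : \bar R := (p a * (xi X a w == r)%:R)%:E.
have F0 a w : (0 <= F a w)%E by rewrite lee_fin mulr_ge0.
have FI a : F a = fun w => ((p a)%:E * (\1_[set w | xi X a w = r] w)%:E)%E.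
  apply/funext => w; rewrite /F EFinM indicE; congr (_ * (_%:R)%:E)%E.
  by congr nat_of_bool; apply/eqP/idP => [?|]; rewrite inE.
have mF a : measurable_fun setT (F a).
  rewrite FI; apply: emeasurable_funM => //.
  by apply/measurable_EFinP/measurable_indic; exact: (iid_count_event a r).1.
have EF w : (occupancy_mass p X r w)%:E = (\esum_(a in [set: A]) F a w)%E.
  rewrite /occupancy_mass fineK// ge0_fin_numE; last first.
    by apply: esum_ge0 => a _; exact: F0.
  apply: le_lt_trans (ltry 1); rewrite -sp1; apply: le_esum => a _.
  by rewrite lee_fin ler_piMr// lern1 leq_b1.
rewrite unlock; under eq_integral do rewrite EF.
rewrite ge0_integral_esum//; apply: eq_esum => a _; rewrite FI.
have mxi := (iid_count_event a r).1.
rewrite ge0_integralZl//; last first.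
- by rewrite lee_fin.
- by apply/measurable_EFinP/measurable_indic.
transitivity ((p a)%:E * P [set w | xi X a w = r])%E.
  by rewrite integral_indic// setIT.
rewrite (iid_count_event a r).2 -EFinM.
by congr EFin; rewrite exprS; ring.
Qed.

End occupancy.

(** * Bounds on a single summand *)

Section pointwise.
Context {R : realType}.
Implicit Types (q : R) (n r : nat).

Lemma onem_expn_le_expR q n : 0 <= q <= 1 ->
  (1 - q) ^+ n <= expR (- (n%:R * q)).
Proof.
move=> /andP[q0 q1]; rewrite -mulrN mulrC expRM_natr.
by apply: lerXn2r; rewrite ?nnegrE ?expR_ge0 ?subr_ge0// expR_ge1Dx.
Qed.

Lemma mul_expRN_le (x : R) : x * expR (- x) <= expR (-1).
Proof.
have := @expR_ge1Dx R (x - 1); rewrite addrC subrK => /ler_wpM2r.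
by move=> /(_ _ (expR_ge0 (- x))); rewrite -expRD addrAC subrr add0r.
Qed.

(** This is one term of the binomial expansion of [(1 - q + q) ^+ n]. *)
Lemma bernstein_le1 q n r : 0 <= q <= 1 ->
  'C(n, r)%:R * q ^+ r * (1 - q) ^+ (n - r) <= 1.
Proof.
move=> /andP[q0 q1]; have q1' : 0 <= 1 - q by rewrite subr_ge0.
have [nr|rn] := ltnP n r; first by rewrite bin_small// !mul0r.
rewrite [leRHS](_ : 1 = (1 - q + q) ^+ n); last by rewrite subrK expr1n.
pose i0 : 'I_n.+1 := Ordinal (rn : (r < n.+1)%N).
rewrite [leRHS]exprDn (bigD1 i0)//=.
rewrite -[X in _ <= X + _]mulr_natl -mulrA [q ^+ r * _]mulrC lerDl.
by apply: sumr_ge0 => i _; rewrite mulrn_wge0// mulr_ge0// exprn_ge0.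
Qed.

Lemma sqrt_pi_le_expR1 : Num.sqrt pi <= expR 1 :> R.
Proof.
have pi4 : pi <= 2 ^+ 2 :> R by have := pihalf_lt2 R; lra.
apply: (le_trans (ler_wsqrtr pi4)); rewrite sqrtr_sqr ger0_norm//.
by have := @expR_ge1Dx R 1; lra.
Qed.

Lemma ffact_le_expn (n r : nat) : (n ^_ r <= n ^ r)%N.
Proof.
elim: r => [|r IH]; first by rewrite ffactn0.
by rewrite ffactnSr expnSr leq_mul// leq_subr.
Qed.

(** For [r = 0] the maximum of [x exp(-x)] is used.  For [r >= 1], the identity
    [(n+1) 'C(n, r) = (r+1) 'C(n+1, r+1)] exhibits a binomial probability with
    [n+1] trials, and [e / sqrt pi >= 1] leaves room. *)
Lemma bernstein_mass_le q n r : (0 < n)%N -> 0 <= q <= 1 ->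
  'C(n, r)%:R * q ^+ r.+1 * (1 - q) ^+ (n - r) <= c_const r / n%:R.
Proof.
move=> n0 q01; have /andP[q0 q1] := q01.
have nR : 0 < n%:R :> R by rewrite ltr0n.
rewrite /c_const; case: eqVneq => [->|r0].
  rewrite bin0 mul1r expr1 subn0 ler_pdivlMr//.
  apply: (le_trans _ (mul_expRN_le (n%:R * q))).
  rewrite mulrC mulrA; apply: ler_wpM2l; first by rewrite mulr_ge0.
  exact: onem_expn_le_expR.
have -> : 'C(n, r)%:R * q ^+ r.+1 * (1 - q) ^+ (n - r) =
    r.+1%:R / n.+1%:R *
    ('C(n.+1, r.+1)%:R * q ^+ r.+1 * (1 - q) ^+ (n.+1 - r.+1)).
  rewrite subSS -!mulrA.
  have := mul_bin_diag n.+1 r => /(congr1 (fun k => k%:R : R)).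
  rewrite !natrM /= => e.
  have -> : 'C(n, r)%:R = r.+1%:R / n.+1%:R * 'C(n.+1, r.+1)%:R :> R.
    by rewrite mulrAC -e mulrC mulKf ?pnatr_eq0.
  by rewrite !mulrA.
apply: (@le_trans _ _ (r.+1%:R / n%:R)).
  rewrite -[leRHS]mulr1; apply: ler_pM => //.
  - by rewrite !mulr_ge0// exprn_ge0// subr_ge0.
  - by rewrite ler_pM2l// lef_pV2 ?posrE// ler_nat.
  - exact: bernstein_le1.
rewrite ler_pM2r ?invr_gt0// mulrAC ler_peMl//.
by rewrite ler_pdivlMr ?mul1r ?sqrt_pi_le_expR1// sqrtr_gt0 pi_gt0.
Qed.

(** The hypothesis on [r] gives [n - r >= n / (r + 1)], which turns the power of
    [1 - q] into an exponential at the rate [n / (r + 1)]. *)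
Lemma bernstein_small_le q n r : (r <= n - 1)%N -> (0 < n)%N -> 0 <= q <= 1 ->
  'C(n, r)%:R * q ^+ r.+1 * (1 - q) ^+ (n - r) <=
  n%:R ^+ r / r`!%:R * (q ^+ r.+1 * expR (- (n%:R / r.+1%:R * q))).
Proof.
move=> rn n0 q01; have /andP[q0 q1] := q01.
rewrite -mulrA; apply: ler_pM => //.
- by rewrite mulr_ge0// exprn_ge0// subr_ge0.
- rewrite ler_pdivlMr ?ltr0n ?fact_gt0// -natrM bin_ffact -natrX ler_nat.
  exact: ffact_le_expn.
- apply: ler_wpM2l; first exact: exprn_ge0.
  apply: (le_trans (onem_expn_le_expR _ q01)); rewrite ler_expR lerN2.
  apply: ler_wpM2r => //; rewrite ler_pdivrMr// -natrM ler_nat.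
  case: n n0 rn {q0 q1 q01} => // n _; rewrite subn1 /= => /subnK <-.
  by rewrite -addSn addnK mulnS leq_add2l leq_pmull.
Qed.

End pointwise.

(** * Power functions and the incomplete Gamma integral *)

Section integrals.
Context {R : realType}.
Notation mu := (@lebesgue_measure R).
Implicit Types (a b c m t x : R) (f : R -> R).

Lemma powR_continuous_gt0 c x : 0 < x ->
  {for x, continuous (fun u : R => u `^ c)}.
Proof.
move=> x0; apply/differentiable_continuous/derivable1_diffP.
by apply: derivable_powR; rewrite in_itv/= x0.
Qed.

Lemma derivable_oo_LRcontinuous_powR c a b : 0 < a -> 0 < b ->
  derivable_oo_LRcontinuous (fun u : R => u `^ c) a b.
Proof.
move=> a0 b0; split.
- move=> x; rewrite in_itv/= => /andP[ax _].
  by apply: derivable_powR; rewrite in_itv/= (lt_trans a0).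
- exact/cvg_at_right_filter/powR_continuous_gt0.
- exact/cvg_at_left_filter/powR_continuous_gt0.
Qed.

Lemma within_continuous_gt0 f a b : 0 < a ->
  (forall x, 0 < x -> {for x, continuous f}) -> {within `[a, b], continuous f}.
Proof.
move=> a0 cf; apply: continuous_in_subspaceT => x.
by rewrite inE/= in_itv/= => /andP[ax _]; apply: cf; exact: lt_le_trans ax.
Qed.

Lemma integral_powR c a b : 0 < a < b -> c != 0 ->
  (\int[mu]_(x in `[a, b]) (x `^ (c - 1))%:E = ((b `^ c - a `^ c) / c)%:E)%E.
Proof.
move=> /andP[a0 ab] c0; have b0 := lt_trans a0 ab.
rewrite (@continuous_FTC2 _ _ (fun x => c^-1 * x `^ c))//.
- by rewrite -EFinB -mulrBr mulrC.
- apply: within_continuous_gt0 => // x x0; exact: powR_continuous_gt0.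
- have [h1 h2 h3] := @derivable_oo_LRcontinuous_powR c a b a0 b0.
  split=> [x xab||].
  + by apply: derivableM => //; exact: h1.
  + by apply: cvgM => //; exact: cvg_cst.
  + by apply: cvgM => //; exact: cvg_cst.
- move=> x; rewrite in_itv/= => /andP[ax _]; have x0 := lt_trans a0 ax.
  have xd : derivable (fun u : R => u `^ c) x 1.
    by apply: derivable_powR; rewrite in_itv/= x0.
  by rewrite derive1Ml//= powR_derive1 ?in_itv/= ?x0// mulrA mulVf// mul1r.
Qed.

Lemma ge0_integral_bigcup_le (F : (set R)^nat) f (C : \bar R) :
  nondecreasing_seq F -> (forall k, measurable (F k)) ->
  (forall k, measurable_fun (F k) f) -> (forall k x, F k x -> 0 <= f x) ->
  (forall k, (\int[mu]_(x in F k) (f x)%:E <= C)%E) ->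
  (\int[mu]_(x in \bigcup_k F k) (f x)%:E <= C)%E.
Proof.
move=> ndF mF mf f0 fC.
have cF : (fun k => \int[mu]_(x in F k) (f x)%:E)%E @ \oo -->
    (\int[mu]_(x in \bigcup_k F k) (f x)%:E)%E.
  apply: ge0_nondecreasing_set_cvg_integral => // k.
  by apply/measurable_EFinP; exact: mf.
rewrite -(cvg_lim _ cF)//; apply: lime_le; last exact: nearW.
by apply/cvg_ex; eexists; exact: cF.
Qed.

Lemma ge0_integral_itvcy_le f a (C : \bar R) :
  measurable_fun `[a, +oo[ f -> (forall x, a <= x -> 0 <= f x) ->
  (forall b, a < b -> (\int[mu]_(x in `[a, b]) (f x)%:E <= C)%E) ->
  (\int[mu]_(x in `[a, +oo[) (f x)%:E <= C)%E.
Proof.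
move=> mf f0 fC.
pose F k := `[a, a + k.+1%:R]%classic : set R.
have -> : `[a, +oo[%classic = \bigcup_k F k.
  apply/seteqP; split=> [x|x [k _]] /=; rewrite /F/= !in_itv/= ?andbT;
    last first.
    by case/andP.
  move=> ax; exists (Num.truncn (x - a)) => //=; rewrite in_itv/= ax/=.
  by rewrite -lerBlDl ltW// truncnS_gt.
apply: ge0_integral_bigcup_le => [k l kl|k|k|k x|k].
- rewrite subsetEset => x; rewrite /F/= !in_itv/= => /andP[-> /le_trans]; apply.
  by rewrite lerD2l ler_nat.
- exact: measurable_itv.
- apply: measurable_funS mf => // x.
  by rewrite /F/= !in_itv/= => /andP[->].
- by rewrite /F/= in_itv/= => /andP[/f0].
- by apply: fC; rewrite ltrDl.
Qed.

Lemma ge0_integral_itvoc_le f b (C : \bar R) : 0 < b ->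
  measurable_fun (`]0%R, b] : set R) f -> (forall x, 0 < x -> 0 <= f x) ->
  (forall a, 0 < a < b -> (\int[mu]_(x in `[a, b]) (f x)%:E <= C)%E) ->
  (\int[mu]_(x in `]0%R, b]) (f x)%:E <= C)%E.
Proof.
move=> b0 mf f0 fC.
pose F k := `[b / k.+2%:R, b]%classic : set R.
have Fp k : 0 < b / k.+2%:R by rewrite divr_gt0.
have -> : `]0%R, b]%classic = \bigcup_k F k.
  apply/seteqP; split=> [x|x [k _]] /=; rewrite /F/= !in_itv/=; last first.
    by move=> /andP[/(lt_le_trans (Fp k)) ->].
  move=> /andP[x0 xb]; exists (Num.truncn (b / x)) => //=.
  rewrite in_itv/= xb andbT ler_pdivrMr// mulrC -ler_pdivrMr// ltW//.
  by rewrite (lt_trans (truncnS_gt _))// ltr_nat.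
apply: ge0_integral_bigcup_le => [k l kl|k|k|k x|k].
- rewrite subsetEset => x; rewrite /F/= !in_itv/= => /andP[+ ->]; rewrite andbT.
  by apply: le_trans; rewrite ler_pM2l// lef_pV2 ?posrE// ler_nat.
- exact: measurable_itv.
- apply: measurable_funS mf => // x.
  by rewrite /F/= !in_itv/= => /andP[/(lt_le_trans (Fp k)) ->].
- by rewrite /F/= in_itv/= => /andP[/(lt_le_trans (Fp k))/f0].
- by apply: fC; rewrite Fp/= ltr_pdivrMr// ltr_pMr// ltr1n.
Qed.

Definition gamma_integrand t u : R := u `^ (t - 1) * expR (- u).

Lemma gamma_integrand_ge0 t u : 0 <= gamma_integrand t u.
Proof. by rewrite mulr_ge0 ?powR_ge0 ?expR_ge0. Qed.

Lemma measurable_gamma_integrand t (D : set R) :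
  measurable_fun D (gamma_integrand t).
Proof.
apply: measurable_funTS; apply: measurable_funM => //.
by apply: measurableT_comp => //; exact: measurableT_comp.
Qed.

(** As the real-valued integral of a function is the finite part of the
    extended one, this also says that the integral is finite: from [a] to [1]
    it is at most that of [u^(t-1)], hence at most [1/t]. *)
Lemma lower_gammaE t : 0 < t ->
  (\int[mu]_(u in `]0%R, 1%R]) (gamma_integrand t u)%:E)%E =
  (lower_gamma t 1)%:E.
Proof.
move=> t0.
have mg : measurable_fun (`]0%R, 1%R] : set R) (EFin \o gamma_integrand t).
  apply/measurable_EFinP; exact: measurable_gamma_integrand.
rewrite /lower_gamma /Rintegral -(integral_itv_obnd_cbnd mg).
rewrite fineK// ge0_fin_numE; last first.
  by apply: integral_ge0 => x _; rewrite lee_fin gamma_integrand_ge0.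
apply: (@le_lt_trans _ _ t^-1%:E); last exact: ltry.
apply: ge0_integral_itvoc_le => //.
- exact: measurable_gamma_integrand.
- by move=> x _; exact: gamma_integrand_ge0.
- move=> a /andP[a0 a1].
  apply: (@le_trans _ _ (\int[mu]_(x in `[a, 1%R]) (x `^ (t - 1))%:E)%E).
    apply: ge0_le_integral => //.
    + by move=> x _; rewrite lee_fin gamma_integrand_ge0.
    + apply/measurable_EFinP; exact: measurable_gamma_integrand.
    + by apply/measurable_EFinP; apply: measurable_funTS.
    + move=> x; rewrite /= in_itv/= => /andP[ax _]; rewrite lee_fin.
      rewrite ler_piMr ?powR_ge0// -expR0 ler_expR oppr_le0.
      by rewrite (le_trans _ ax)// ltW.
  rewrite integral_powR ?a0 ?gt_eqF// lee_fin powR1 -[leRHS]mul1r.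
  by rewrite ler_pM2r ?invr_gt0// gerBl powR_ge0.
Qed.

(** The Gamma integrand after the substitution [u = m / w], without its
    factor [m ^ t]. *)
Definition inv_gamma_integrand t m w : R :=
  w `^ (- t - 1) * expR (- (m * w `^ (-1))).

Lemma inv_gamma_integrand_ge0 t m w : 0 <= inv_gamma_integrand t m w.
Proof. by rewrite mulr_ge0 ?powR_ge0 ?expR_ge0. Qed.

Lemma measurable_inv_gamma_integrand t m (D : set R) :
  measurable_fun D (inv_gamma_integrand t m).
Proof.
apply: measurable_funTS; apply: measurable_funM => //.
apply: measurableT_comp => //; apply: measurableT_comp => //.
exact: measurable_funM.
Qed.

Lemma derive1_inv m x : 0 < x ->
  (fun w : R => m * w `^ (-1))^`()%classic x = m * (-1 * x `^ (-1 - 1)).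
Proof.
move=> x0; rewrite derive1Ml ?powR_derive1 ?in_itv/= ?x0//.
by apply: derivable_powR; rewrite in_itv/= x0.
Qed.

Lemma continuous_derive1_inv m x : 0 < x ->
  {for x, continuous ((fun w : R => m * w `^ (-1))^`()%classic)}.
Proof.
move=> x0; rewrite /prop_for /continuous_at derive1_inv//.
have : (fun w : R => m * (-1 * w `^ (-1 - 1))) @ x --> m * (-1 * x `^ (-1 - 1)).
  apply: cvgM; first exact: cvg_cst.
  apply: cvgM; first exact: cvg_cst.
  exact: powR_continuous_gt0.
apply: cvg_trans; apply: near_eq_cvg.
near=> w; rewrite derive1_inv//.
near: w; exact: lt_nbhsr.
Unshelve. all: by end_near. Qed.

Lemma integral_inv_gamma t m a b : 0 < m -> 0 < a < b ->
  (\int[mu]_(w in `[a, b]) (inv_gamma_integrand t m w)%:E =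
   (m `^ (- t))%:E *
   \int[mu]_(u in `[(m * b `^ (-1))%R, (m * a `^ (-1))%R])
     (gamma_integrand t u)%:E)%E.
Proof.
move=> m0 /andP[a0 ab]; have b0 := lt_trans a0 ab.
pose F w : R := m * w `^ (-1).
have F0 w : 0 < w -> 0 < F w by move=> w0; rewrite mulr_gt0 ?powR_gt0.
have mK : m `^ (- t) * m `^ t = 1.
  by rewrite -powRD ?addNr ?powRr0// (gt_eqF m0) implybT.
suff -> : (\int[mu]_(u in `[F b, F a]) (gamma_integrand t u)%:E =
    (m `^ t)%:E * \int[mu]_(w in `[a, b]) (inv_gamma_integrand t m w)%:E)%E.
  by rewrite muleA -EFinM mK mul1e.
rewrite (@integration_by_substitution_decreasing _ F (gamma_integrand t)).
- rewrite -ge0_integralZl//; last 3 first.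
  + apply/measurable_EFinP; exact: measurable_inv_gamma_integrand.
  + by move=> x _; rewrite lee_fin inv_gamma_integrand_ge0.
  + by rewrite lee_fin powR_ge0.
  apply: eq_integral => w; rewrite inE/= in_itv/= => /andP[aw _].
  have w0 := lt_le_trans a0 aw.
  rewrite -EFinM; congr EFin.
  change (gamma_integrand t (F w) * - (F^`()%classic w) =
    m `^ t * inv_gamma_integrand t m w).
  rewrite derive1_inv// /gamma_integrand /inv_gamma_integrand /F.
  rewrite powRM ?(ltW m0) ?powR_ge0// -powRrM.
  have -> : w `^ (- t - 1) = w `^ (-1 * (t - 1)) * w `^ (-1 - 1).
    rewrite -powRD; last by rewrite (gt_eqF w0) implybT.
    by congr powR; ring.
  have mt : m `^ t = m `^ (t - 1) * m.
    rewrite -{3}(powRr1 (ltW m0)) -powRD ?subrK// (gt_eqF m0).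
    by rewrite implybT.
  by rewrite mt; ring.
- exact: ltW.
- move=> x y; rewrite !in_itv/= => /andP[ax _] /andP[ay _] xy.
  have x0 := lt_le_trans a0 ax; have y0 := lt_le_trans a0 ay.
  by rewrite /F ltr_pM2l// !powR_inv1 ?(ltW x0) ?(ltW y0)// ltf_pV2.
- move=> x; rewrite in_itv/= => /andP[ax _].
  by apply: continuous_derive1_inv; exact: lt_trans ax.
- apply/cvg_ex; exists (F^`()%classic a).
  by apply: cvg_at_right_filter; exact: continuous_derive1_inv.
- apply/cvg_ex; exists (F^`()%classic b).
  by apply: cvg_at_left_filter; exact: continuous_derive1_inv.
- have [h1 h2 h3] := @derivable_oo_LRcontinuous_powR (-1) a b a0 b0.
  split=> [x xab||].
  + by apply: derivableM => //; exact: h1.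
  + by apply: cvgM => //; exact: cvg_cst.
  + by apply: cvgM => //; exact: cvg_cst.
- apply: within_continuous_gt0 => [|x x0]; first exact: F0.
  apply: cvgM; first exact: powR_continuous_gt0.
  apply: continuous_comp; first exact: opp_continuous.
  exact: continuous_expR.
Qed.

(** Since [m <= a], the range [0 < u <= m / a] lies in [0 < u <= 1]. *)
Lemma integral_inv_gamma_le t m a : 0 < t -> 0 < m <= a ->
  (\int[mu]_(w in `[a, +oo[) (inv_gamma_integrand t m w)%:E <=
   (m `^ (- t) * lower_gamma t 1)%:E)%E.
Proof.
move=> t0 /andP[m0 ma]; have a0 := lt_le_trans m0 ma.
apply: ge0_integral_itvcy_le => [|x _|b ab].
- exact: measurable_inv_gamma_integrand.
- exact: inv_gamma_integrand_ge0.
have b0 := lt_trans a0 ab.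
rewrite integral_inv_gamma ?a0// EFinM; apply: lee_wpmul2l.
  by rewrite lee_fin powR_ge0.
rewrite -lower_gammaE//; apply: ge0_subset_integral => //.
- apply/measurable_EFinP; exact: measurable_gamma_integrand.
- by move=> x _; rewrite lee_fin gamma_integrand_ge0.
move=> x; rewrite /= !in_itv/= !powR_inv1 ?(ltW a0) ?(ltW b0)//.
move=> /andP[bx xa]; apply/andP; split.
  by apply: lt_le_trans bx; rewrite divr_gt0.
by apply: (le_trans xa); rewrite ler_pdivrMr// mul1r.
Qed.

(** * The dyadic weight and the Cauchy-Schwarz inequality *)

(** In the scale [eps = 1/w] this is the density [eps^r exp(- m eps / 2)]. *)
Definition dyadic_weight (r : nat) m w : R :=
  w `^ (- r.+2%:R) * expR (- (m * w `^ (-1) / 2)).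

Lemma dyadic_weight_ge0 r m w : 0 <= dyadic_weight r m w.
Proof. by rewrite mulr_ge0 ?powR_ge0 ?expR_ge0. Qed.

Lemma measurable_dyadic_weight r m (D : set R) :
  measurable_fun D (dyadic_weight r m).
Proof.
apply: measurable_funTS; apply: measurable_funM => //.
apply: measurableT_comp => //; apply: measurableT_comp => //.
apply: measurable_funM => //; exact: measurable_funM.
Qed.

(** On this range [w^-1] lies between [q / 2] and [q], so that
    [h(w) >= (q/2)^r exp(- m q) w^-2]; keeping [w^-2] and integrating it exactly
    to [q / 2] is what yields the constant [2 ^ (r+1)]. *)
Lemma dyadic_weight_integral_ge r m (q : R) : 0 <= m -> 0 < q ->
  ((q ^+ r.+1 * expR (- (m * q)))%:E <=
   (2 ^+ r.+1)%:E *
   \int[mu]_(w in `[q^-1%R, (2 / q)%R]) (dyadic_weight r m w)%:E)%E.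
Proof.
move=> m0 q0; have iq0 : 0 < q^-1 by rewrite invr_gt0.
pose c := (q / 2) ^+ r * expR (- (m * q)).
have c0 : 0 <= c by rewrite mulr_ge0 ?expR_ge0// exprn_ge0// divr_ge0// ltW.
apply: (@le_trans _ _ ((2 ^+ r.+1)%:E *
    \int[mu]_(w in `[q^-1%R, (2 / q)%R]) (c%:E * (w `^ (-1 - 1))%:E))%E).
  rewrite ge0_integralZl//; last 2 first.
  - by apply/measurable_EFinP; exact: measurable_funTS.
  - by move=> x _; rewrite lee_fin powR_ge0.
  rewrite integral_powR ?iq0 ?ltr_pMl ?ltr1n ?oppr_eq0//.
  rewrite -!EFinM lee_fin !powR_inv1 ?(ltW iq0) ?divr_ge0 ?(ltW q0)//.
  rewrite invrK invf_div.
  rewrite [leRHS](_ : _ = q ^+ r.+1 * expR (- (m * q))) // /c.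
  by rewrite expr_div_n !exprS; field; rewrite expf_neq0.
apply: lee_wpmul2l; first by rewrite lee_fin exprn_ge0.
apply: ge0_le_integral => //.
- by move=> x _; rewrite -EFinM lee_fin mulr_ge0 ?powR_ge0.
- apply/measurable_EFinP; apply: measurable_funM => //; exact: measurable_funTS.
- apply/measurable_EFinP; exact: measurable_dyadic_weight.
move=> w; rewrite /= in_itv/= => /andP[qw wq]; rewrite -EFinM lee_fin.
have w0 := lt_le_trans iq0 qw.
rewrite /dyadic_weight (_ : - r.+2%:R = - r%:R + (-1 - 1)); last first.
  by rewrite -[in LHS]addn2 natrD; ring.
rewrite [w `^ (- r%:R + _)]powRD ?(gt_eqF w0) ?implybT// /c mulrAC.
apply: ler_pM.
- by rewrite mulr_ge0 ?powR_ge0 ?exprn_ge0 ?divr_ge0 ?(ltW q0).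
- exact: expR_ge0.
- apply: ler_wpM2r; first exact: powR_ge0.
  rewrite powR_invn ?(ltW w0)// -exprVn; apply: lerXn2r.
  - by rewrite nnegrE divr_ge0 ?(ltW q0).
  - by rewrite nnegrE invr_ge0 (ltW w0).
  by rewrite -[_ / 2]invrK lef_pV2 ?posrE ?invr_gt0 ?divr_gt0// invf_div.
- rewrite ler_expR lerN2 powR_inv1 ?(ltW w0)//.
  rewrite -mulrA; apply: ler_wpM2l => //.
  have : w^-1 <= q by rewrite -[q]invrK lef_pV2 ?posrE.
  have : 0 < w^-1 by rewrite invr_gt0.
  lra.
Qed.

Lemma cauchy_schwarz (D : set R) f (g : R -> R) : measurable D ->
  measurable_fun D f -> measurable_fun D g ->
  (forall x, D x -> 0 <= f x) -> (forall x, D x -> 0 <= g x) ->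
  (\int[mu]_(x in D) (f x * g x)%:E <=
   sqrte (\int[mu]_(x in D) (f x ^+ 2)%:E) *
   sqrte (\int[mu]_(x in D) (g x ^+ 2)%:E))%E.
Proof.
move=> mD mf mg f0 g0.
have mpf : measurable_fun setT (f \_ D) by apply/(measurable_restrictT _ mD).
have mpg : measurable_fun setT (g \_ D) by apply/(measurable_restrictT _ mD).
have L2 (h : R -> R) : 'N[mu]_2%:E[EFin \o (h \_ D)]%E =
    sqrte (\int[mu]_(x in D) (h x ^+ 2)%:E)%E.
  rewrite [in LHS]unlock poweR12_sqrt; last first.
    by apply: integral_ge0 => x _; exact: poweR_ge0.
  congr sqrte; rewrite [RHS]integral_mkcond; apply: eq_integral => x _.
  rewrite /= /patch; case: ifPn => _; last first.
    by change ((`|0 : R| `^ 2)%:E = 0 :> \bar R); rewrite normr0 powR0.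
  by rewrite powR_mulrn// real_normK ?num_real.
have := @hoelder _ _ R mu (f \_ D) (g \_ D) 2 2 mpf mpg.
rewrite -div1r -splitr => /(_ (ltr0Sn _ _) (ltr0Sn _ _) erefl).
rewrite !L2; apply: le_trans; rewrite Lnorm1 [leLHS]integral_mkcond.
rewrite le_eqVlt; apply/orP; left; apply/eqP.
apply: eq_integral => x _; rewrite /= /patch; case: ifPn => [|_].
  by rewrite inE => xD; rewrite ger0_norm// mulr_ge0 ?f0 ?g0.
by change ((0 : \bar R) = `|0 * 0 : R|%:E); rewrite mul0r normr0.
Qed.

End integrals.

(** * The counting function on a dyadic scale *)

Section counting_function.
Context {R : realType} {A : countType}.
Implicit Types (p : A -> R) (x u K : R).

Lemma nu_esum p x (C : R) : (nu p x <= C%:E)%E ->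
  nu p x = (\esum_(a in [set: A]) ((x <= p a)%R%:R)%:E)%E.
Proof.
move=> nuC; rewrite /nu counting_esum.
  by apply: eq_esum => a _; rewrite indicE mem_setE.
move: nuC; rewrite /nu /counting; case: asboolP => //.
Qed.

Lemma nu_fin p x (C : R) : (nu p x <= C%:E)%E ->
  exists2 V : R, 0 <= V & nu p x = V%:E.
Proof.
move=> nuC; have nu0 : (0 <= nu p x)%E.
  by rewrite /nu /counting; case: ifP => // _; rewrite lee_fin.
have fV : nu p x \is a fin_num.
  by rewrite ge0_fin_numE// (le_lt_trans nuC) ?ltry.
by exists (fine (nu p x)); rewrite ?fine_ge0 ?fineK.
Qed.

(** The sum is [nu(u/2) - nu(u)], at most [(K - 1) nu(u)], and
    [nu(u) <= nu(u/2)]. *)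
Lemma dyadic_count_le p u K (C1 C2 : R) : 0 < u -> (nu p u <= C1%:E)%E ->
  (nu p (u / 2) <= C2%:E)%E -> (nu_ratio p u <= K%:E)%E ->
  (\esum_(a in [set: A]) ((u / 2 <= p a < u)%R%:R)%:E <=
   (K - 1)%:E * nu p (u / 2)%R)%E.
Proof.
move=> u0 nu1 nu2; set N := (\esum_(a in _) _)%E.
have split_nu : nu p (u / 2) = (N + nu p u)%E.
  rewrite (nu_esum nu1) (nu_esum nu2) -esumD; last 2 first.
  - by move=> a _; rewrite lee_fin.
  - by move=> a _; rewrite lee_fin.
  apply: eq_esum => a _; rewrite -EFinD; congr EFin.
  case: (leP u (p a)) => ua /=; rewrite ?andbF ?andbT ?addr0 ?add0r//.
  by rewrite (_ : _ <= _); [|lra].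
have [V1 V10 V1E] := nu_fin nu1; have [V2 V20 V2E] := nu_fin nu2.
have N0 : (0 <= N)%E by apply: esum_ge0 => a _; rewrite lee_fin.
rewrite /nu_ratio V2E V1E.
have V2N : V2%:E = (N + V1%:E)%E by rewrite -V1E -V2E.
case: eqVneq => //= V1n0; clearbody N.
case: N V2N N0 {split_nu} => [N||]//= [] V2N; rewrite lee_fin => N0.
have V1p : 0 < V1 by rewrite lt_def V10 andbT; move: V1n0; rewrite eqe.
rewrite inver (gt_eqF V1p) -!EFinM !lee_fin ler_pdivrMr// => VK.
nra.
Qed.

End counting_function.

(** * Heavy and light atoms *)

Section sums.
Context {R : realType} {A : countType}.
Notation mu := (@lebesgue_measure R).
Variables (p : A -> R) (alpha : R) (ell : R -> R).
Hypothesis p01 : forall a, 0 <= p a <= 1.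
Hypothesis nu_le : forall eps : R, 0 < eps <= 1 ->
  (nu p eps <= (eps `^ (- alpha) * ell eps^-1)%:E)%E.
Variables (n r : nat).
Hypothesis n_gt0 : (0 < n)%N.

Definition occupancy_term a : R :=
  'C(n, r)%:R * p a ^+ r.+1 * (1 - p a) ^+ (n - r).

Lemma occupancy_term_ge0 a : 0 <= occupancy_term a.
Proof.
have /andP[p0 p1] := p01 a.
by rewrite !mulr_ge0 ?exprn_ge0 ?subr_ge0.
Qed.

Lemma nu_inv_le w : 1 <= w -> (nu p w^-1 <= (w `^ alpha * ell w)%:E)%E.
Proof.
move=> w1; have w0 : 0 < w by apply: lt_le_trans w1.
have /nu_le : 0 < w^-1 <= 1 by rewrite invr_gt0 w0 invf_le1.
rewrite invrK; have -> // : w^-1 `^ (- alpha) = w `^ alpha.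
by rewrite -[w^-1]powR_inv1 ?(ltW w0)// -powRrM mulrNN mul1r.
Qed.

Lemma heavy_sum_le :
  (\esum_(a in [set: A]) (if n%:R^-1 <= p a then occupancy_term a else 0)%:E <=
   (c_const r * n%:R `^ (alpha - 1) * ell n%:R)%:E)%E.
Proof.
have n1 : 1 <= n%:R :> R by rewrite ler1n.
have n0 : 0 < n%:R :> R by rewrite ltr0n.
have c0 : 0 <= c_const r / n%:R :> R.
  have := @bernstein_mass_le R 0 n r n_gt0.
  by rewrite lexx ler01 expr0n mulr0 mul0r; apply.
apply: (@le_trans _ _ ((c_const r / n%:R)%:E * nu p n%:R^-1%R)%E).
  rewrite (nu_esum (nu_inv_le n1)) -esumZl//.
  apply: le_esum => a _; rewrite -EFinM lee_fin.
  by case: ifP => _; rewrite ?mulr1 ?mulr0// bernstein_mass_le.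
apply: (@le_trans _ _
  ((c_const r / n%:R)%:E * (n%:R `^ alpha * ell n%:R)%:E)%E).
  by apply: lee_wpmul2l; [rewrite lee_fin|exact: nu_inv_le].
rewrite -EFinM lee_fin powRD; last by rewrite (gt_eqF n0) implybT.
rewrite powR_inv1 ?(ltW n0)//.
by rewrite le_eqVlt; apply/orP; left; apply/eqP; ring.
Qed.

Hypothesis r_le : (r <= n - 1)%N.
Variable K : R.
Hypothesis nu_ratio_le : forall u : R, 0 < u <= 2 / n%:R ->
  (nu_ratio p u <= K%:E)%E.
Hypothesis K1 : 1 <= K.
Hypothesis n_ge2 : (2 <= n)%N.

Let m : R := n%:R / r.+1%:R.

(** For [0 < w] this is [1/w <= q < 2/w], and for [0 < q] it is
    [1/q <= w < 2/q]: the sum over atoms reads it the first way, the integral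
    over scales the second. *)
Definition in_dyadic (w q : R) : bool := 1 <= q * w < 2.

(** As [p a < 1/n], the whole range [1/p_a <= w < 2/p_a] lies in [w >= n], so
    that the integral can be taken over a domain independent of [a]. *)
Lemma light_term_le a :
  ((if n%:R^-1 <= p a then 0 else occupancy_term a)%:E <=
   (n%:R ^+ r / r`!%:R * 2 ^+ r.+1)%:E *
   \int[mu]_(w in `[n%:R, +oo[)
     (dyadic_weight r m w * (in_dyadic w (p a))%:R)%:E)%E.
Proof.
have n0 : 0 < n%:R :> R by rewrite ltr0n.
have c0 : 0 <= n%:R ^+ r / r`!%:R * 2 ^+ r.+1 :> R.
  by rewrite mulr_ge0 ?exprn_ge0// divr_ge0 ?exprn_ge0.
have i0 q : (0 <= \int[mu]_(w in `[n%:R, +oo[)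
     (dyadic_weight r m w * (in_dyadic w q)%:R)%:E)%E.
  by apply: integral_ge0 => w _; rewrite lee_fin mulr_ge0 ?dyadic_weight_ge0.
case: ifPn => [_|]; first by rewrite mule_ge0.
rewrite -ltNge => pan; have /andP[] := p01 a; rewrite le_eqVlt.
move=> /predU1P[pa0 _|pa0 p1].
  by rewrite /occupancy_term -pa0 expr0n mulr0 mul0r mule_ge0// lee_fin.
apply: (@le_trans _ _
  (n%:R ^+ r / r`!%:R * (p a ^+ r.+1 * expR (- (m * p a))))%:E).
  by rewrite lee_fin; exact: bernstein_small_le.
rewrite [leLHS]EFinM [(_ * 2 ^+ _)%:E]EFinM -muleA; apply: lee_wpmul2l.
  by rewrite lee_fin divr_ge0 ?exprn_ge0.
have m0 : 0 <= m by rewrite divr_ge0.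
apply: (le_trans (dyadic_weight_integral_ge r m0 pa0)).
apply: lee_wpmul2l; first by rewrite lee_fin exprn_ge0.
have mh (D : set R) : measurable_fun D (EFin \o dyadic_weight r m).
  by apply/measurable_EFinP; exact: measurable_dyadic_weight.
rewrite -(integral_itv_bndo_bndc (mh _)).
rewrite integral_mkcond [leRHS]integral_mkcond.
rewrite le_eqVlt; apply/orP; left; apply/eqP; apply: eq_integral => w _.
rewrite /patch !mem_setE !in_itv/= andbT /in_dyadic.
have [nw|wn] := leP n%:R w; last first.
  have : n%:R < (p a)^-1 by rewrite -[n%:R]invrK ltf_pV2 ?posrE ?invr_gt0.
  by move=> /(lt_trans wn); rewrite ltNge => /negbTE ->.
have w0 := lt_le_trans n0 nw.
have -> : ((p a)^-1 <= w < 2 / p a) = (1 <= p a * w < 2).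
  by rewrite ltr_pdivlMr// -[(p a)^-1]mul1r ler_pdivrMr// mulrC.
by case: ifP => _; rewrite ?mulr1 ?mulr0.
Qed.

(** Cauchy-Schwarz is applied in extended reals, which covers the case where
    [ell_circ] is infinite. *)
Lemma light_sum_le beta : 0 < beta < 1 ->
  measurable_fun (`[0%R, +oo[ : set R) ell ->
  2 * (alpha - r%:R) - 1 < beta ->
  (\esum_(a in [set: A]) (if n%:R^-1 <= p a then 0 else occupancy_term a)%:E <=
   (n%:R ^+ r / r`!%:R * 2 ^+ r.+1 * (K - 1) *
    Num.sqrt (m `^ (- (1 + beta + 2 * (r%:R - alpha))) *
       lower_gamma (1 + beta + 2 * (r%:R - alpha)) 1))%:E *
   ell_circ ell beta (n%:R / 2)%R)%E.
Proof.
move=> /andP[beta0 beta1] mell beta_gt.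
have n0 : 0 < n%:R :> R by rewrite ltr0n.
have c0 : 0 <= n%:R ^+ r / r`!%:R * 2 ^+ r.+1 :> R.
  by rewrite mulr_ge0 ?exprn_ge0// divr_ge0 ?exprn_ge0.
set t := 1 + beta + 2 * (r%:R - alpha).
have t0 : 0 < t by rewrite /t; lra.
pose D := `[(n%:R : R), +oo[%classic.
have mD : measurable D by exact: measurable_itv.
have Dw w : D w -> [/\ n%:R <= w, 1 <= w & 0 < w].
  rewrite /D/= in_itv/= andbT => nw; split=> //.
    by apply: le_trans nw; rewrite ler1n.
  exact: lt_le_trans nw.
(* the weight times [w ^ alpha * ell w] factors as [f w * g w], the powers of
   [w] being shared out so that [g ^ 2] is the integrand of [ell_circ] *)
pose f w := w `^ ((- t - 1) / 2) * expR (- (m * w `^ (-1) / 2)).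
pose g w := ell w * w `^ (- ((2 - beta) / 2)).
have mw a : measurable_fun D (fun w : R => w `^ a) by exact: measurable_funTS.
have f0 w : D w -> 0 <= f w by move=> _; rewrite mulr_ge0 ?powR_ge0 ?expR_ge0.
have ell0 w : D w -> 0 <= ell w.
  move=> /Dw[_ w1 w0]; have := nu_fin (nu_inv_le w1) => -[V V0 VE].
  have := nu_inv_le w1; rewrite VE lee_fin => /(le_trans V0).
  by rewrite pmulr_rge0 ?powR_gt0.
have g0 w : D w -> 0 <= g w by move=> Dw'; rewrite mulr_ge0 ?powR_ge0 ?ell0.
have mf : measurable_fun D f.
  apply: measurable_funM => //; apply: measurableT_comp => //.
  apply: measurableT_comp => //; apply: measurable_funM => //.
  exact: measurable_funM.
have mg : measurable_fun D g.
  apply: measurable_funM => //; apply: measurable_funS mell => // w /Dw[_ _ w0].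
  by rewrite /= in_itv/= (ltW w0).
have mdy a : measurable_fun D (fun w => (in_dyadic w (p a))%:R : R).
  have mb : measurable_fun D (fun w : R => in_dyadic w (p a)).
    apply: measurable_and.
      by apply: measurable_fun_ler => //; exact: measurable_funM.
    by apply: measurable_fun_ltr => //; exact: measurable_funM.
  have -> : (fun w => (in_dyadic w (p a))%:R : R) =
      (fun b : bool => b%:R : R) \o (fun w => in_dyadic w (p a)) by [].
  by apply: measurableT_comp.
have mh : measurable_fun D (dyadic_weight r m).
  exact: measurable_dyadic_weight.
apply: (@le_trans _ _ ((n%:R ^+ r / r`!%:R * 2 ^+ r.+1)%:E *
   \int[mu]_(w in D) ((dyadic_weight r m w)%:E *
      \esum_(a in [set: A]) ((in_dyadic w (p a))%:R : R)%:E))%E).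
  rewrite (le_trans (le_esum (fun a _ => light_term_le a)))//.
  rewrite esumZl//; last first.
    move=> a; apply: integral_ge0 => w _.
    by rewrite lee_fin mulr_ge0 ?dyadic_weight_ge0.
  apply: lee_wpmul2l; first by rewrite lee_fin.
  rewrite -ge0_integral_esum//; last 2 first.
  - by move=> a; apply/measurable_EFinP; exact: (measurable_funM mh (mdy a)).
  - by move=> a w; rewrite lee_fin mulr_ge0 ?dyadic_weight_ge0.
  rewrite le_eqVlt; apply/orP; left; apply/eqP; apply: eq_integral => w _.
  by rewrite -esumZl ?dyadic_weight_ge0.
apply: (@le_trans _ _ ((n%:R ^+ r / r`!%:R * 2 ^+ r.+1)%:E *
   \int[mu]_(w in D) ((K - 1)%:E * (f w * g w)%:E))%E).
  apply: lee_wpmul2l; first by rewrite lee_fin.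
  apply: ge0_le_integral => //.
  - move=> w _; apply: mule_ge0; first by rewrite lee_fin dyadic_weight_ge0.
    by apply: esum_ge0 => a _; rewrite lee_fin.
  - apply: emeasurable_funM; first exact/measurable_EFinP.
    by apply: measurable_fun_esum => // a; apply/measurable_EFinP; exact: mdy.
  - apply: emeasurable_funM => //; apply/measurable_EFinP.
    exact: measurable_funM.
  move=> w /Dw[nw w1 w0].
  have hw : dyadic_weight r m w * w `^ alpha * ell w = f w * g w.
    rewrite /dyadic_weight /f /g.
    have -> : w `^ (- r.+2%:R) =
        w `^ ((- t - 1) / 2) * w `^ (- ((2 - beta) / 2)) * w `^ (- alpha).
      rewrite -!powRD ?(gt_eqF w0) ?implybT//; congr powR.
      by rewrite /t -[r.+2]addn2 natrD; field.
    have wK : w `^ (- alpha) * w `^ alpha = 1.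
      by rewrite -powRD ?addNr ?powRr0// (gt_eqF w0) implybT.
    by rewrite -[RHS]mulr1 -wK; ring.
  rewrite -hw -mulrA [X in (_ <= _ * X)%E]EFinM [leRHS]muleCA.
  apply: lee_wpmul2l.
    by rewrite lee_fin dyadic_weight_ge0.
  have u0 : 0 < 2 / w by rewrite divr_gt0.
  have uw : 2 / w / 2 = w^-1 by field; rewrite gt_eqF.
  have un : 2 / w <= 2 / n%:R by rewrite ler_pM2l// lef_pV2.
  have u1 : 2 / w <= 1.
    by apply: (le_trans un); rewrite ler_pdivrMr// mul1r ler_nat.
  have nu1 := nu_le (_ : 0 < 2 / w <= 1).
  have nu2 : (nu p (2 / w / 2) <= (w `^ alpha * ell w)%:E)%E.
    by rewrite uw; exact: nu_inv_le.
  have inE' a : in_dyadic w (p a) = (2 / w / 2 <= p a < 2 / w).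
    by rewrite uw ltr_pdivlMr// -[w^-1]mul1r ler_pdivrMr.
  under eq_esum do rewrite inE'.
  have := dyadic_count_le u0 (nu1 _) nu2 (nu_ratio_le _).
  rewrite u0 u1 un => /(_ isT isT); rewrite uw => h.
  apply: (le_trans h); apply: lee_wpmul2l; first by rewrite lee_fin subr_ge0.
  exact: nu_inv_le.
rewrite ge0_integralZl//; last 3 first.
- by apply/measurable_EFinP; exact: measurable_funM.
- by move=> w Dw'; rewrite lee_fin mulr_ge0 ?f0 ?g0.
- by rewrite lee_fin subr_ge0.
rewrite muleA -EFinM [in leRHS]EFinM -muleA; apply: lee_wpmul2l.
  by rewrite lee_fin mulr_ge0// subr_ge0.
apply: (le_trans (cauchy_schwarz _ mf mg f0 g0)) => //.
apply: lee_pmul; rewrite ?sqrte_ge0//.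
  have m0 : 0 < m by rewrite divr_gt0.
  have mn : m <= n%:R by rewrite ler_pdivrMr// ler_peMr// ?ler1n// ltW.
  have J := @integral_inv_gamma_le R t m n%:R t0.
  rewrite (_ : (Num.sqrt _)%:E = sqrte (m `^ (- t) * lower_gamma t 1)%:E)%E//.
  rewrite lee_sqrt; last first.
    apply: le_trans (J _); last by rewrite m0.
    by apply: integral_ge0 => w _; rewrite lee_fin inv_gamma_integrand_ge0.
  apply: le_trans (J _); last by rewrite m0.
  rewrite le_eqVlt; apply/orP; left; apply/eqP; apply: eq_integral => w.
  rewrite inE => /Dw[_ _ w0]; congr EFin.
  rewrite /f /inv_gamma_integrand exprMn -[(_ `^ _) ^+ 2]powR_mulrn ?powR_ge0//.
  by rewrite -powRrM divfK// -expRM_natr mulNr divfK.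
rewrite /ell_circ lee_sqrt; last first.
  by apply: integral_ge0 => w _; rewrite lee_fin divr_ge0 ?sqr_ge0 ?powR_ge0.
rewrite (_ : 2 * (n%:R / 2) = n%:R); last by field.
rewrite le_eqVlt; apply/orP; left; apply/eqP; apply: eq_integral => w.
rewrite inE => /Dw[_ _ w0]; congr EFin.
rewrite /g exprMn -[in LHS](@powR_mulrn _ (_ `^ _)) ?powR_ge0//.
by rewrite -powRrM mulNr divfK// powRN.
Qed.

End sums.

Theorem corollary2p4 (R : realType) (A : countType) (p : A -> R)
  (p_distr : is_distribution p)
  (supp_infinite : infinite_set (support_of p))
  (kappa0_gt1 : (1 < kappa0 p)%E) (kappa0_le2 : (kappa0 p <= 2%:E)%E)
  (alpha : R) (alpha01 : 0 <= alpha <= 1)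
  (ell : R -> R) (ell_sv : slowly_varying ell)
  (nu_le : forall eps : R, 0 < eps <= 1 ->
    (nu p eps <= (eps `^ (- alpha) * ell eps^-1)%:E)%E)
  (n : nat) (n_ge2 : (2 <= n)%N)
  (n_large : (kappa p (2 / n%:R)%R <= 2%:E * kappa0 p - 1)%E)
  (d : measure_display) (T : measurableType d) (P : probability T R)
  (X : 'I_n -> T -> A) (X_iid : iid_sample P p X)
  (r : nat) (r_le : (r <= n - 1)%N)
  (beta : R) (beta01 : 0 < beta < 1)
  (beta_gt : 2 * (alpha - r%:R) - 1 < beta) :
  ('E_P[occupancy_mass p X r] <=
     (c_const r * n%:R `^ (alpha - 1) * ell n%:R)%:E +
     (kappa0 p - 1) * (c2_const alpha beta r)%:E *
     ((n%:R / 2) `^ (alpha - (1 + beta) / 2))%:E *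
     ell_circ ell beta (n%:R / 2)%R)%E.
Proof.
have n_gt0 : (0 < n)%N by exact: leq_trans n_ge2.
have n0 : 0 < n%:R :> R by rewrite ltr0n.
have p01 := p_distr.1.
have [k k1 kE] : exists2 k : R, 1 < k & kappa0 p = k%:E.
  move: kappa0_gt1 kappa0_le2; case: (kappa0 p) => [k|//|//] k1 _.
  by exists k.
rewrite {}kE -EFinM -EFinB in kappa0_gt1 kappa0_le2 n_large *.
set K := 2 * k - 1 in n_large.
have nu_ratio_le (u : R) : 0 < u <= 2 / n%:R -> (nu_ratio p u <= K%:E)%E.
  move=> un; apply: le_trans n_large.
  by apply: ereal_sup_ubound; exists u.
have K1 : 1 <= K by rewrite /K; lra.
rewrite (expectation_occupancy_mass X_iid)//.
have heavy := @heavy_sum_le R A p alpha ell p01 nu_le n r n_gt0.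
have light := @light_sum_le R A p alpha ell p01 nu_le n r n_gt0 r_le K
  nu_ratio_le K1 n_ge2 beta beta01 ell_sv.1 beta_gt.
set t := 1 + beta + _ in light.
apply: (le_trans _ (le_trans (leeD heavy light) _)).
  rewrite -esumD.
  - apply: le_esum => a _; rewrite -EFinD lee_fin -/(occupancy_term p n r a).
    by case: ifP => _; rewrite ?addr0 ?add0r.
  - move=> a _; rewrite lee_fin; case: ifP => // _.
    exact: occupancy_term_ge0.
  - move=> a _; rewrite lee_fin; case: ifP => // _.
    exact: occupancy_term_ge0.
rewrite leeD2l// -!EFinM.
(* both bounds are a constant times [ell_circ]; the constants agree because
   [n / 2] is the product of [n / (r + 1)] and [(r + 1) / 2] *)
set c1 := (X in (X%:E * _ <= _)%E); set c2 := (X in (_ <= X%:E * _)%E).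
suff -> : c1 = c2 by [].
rewrite {}/c1 {}/c2 /c2_const -/t sqrtrM ?powR_ge0//.
set G := Num.sqrt (lower_gamma t 1).
set s := (1 + beta) / 2 + r%:R - alpha.
have r0 : 0 < r.+1%:R / 2 :> R by rewrite divr_gt0.
have m0 : 0 < n%:R / r.+1%:R :> R by rewrite divr_gt0.
have sqrt_m : Num.sqrt ((n%:R / r.+1%:R) `^ (- t)) =
    (n%:R / r.+1%:R) `^ (- s) :> R.
  rewrite -powR12_sqrt ?powR_ge0// -powRrM; congr powR.
  by rewrite /t /s; field.
have n_pow : (n%:R / 2) `^ (alpha - (1 + beta) / 2) =
    (n%:R / 2) ^+ r * ((n%:R / r.+1%:R) `^ (- s) * (r.+1%:R / 2) `^ (- s)) :> R.
  rewrite -powRM ?(ltW m0) ?(ltW r0)// mulrA divfK ?pnatr_eq0//.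
  rewrite -powR_mulrn ?divr_ge0// -powRD; last first.
    by rewrite (gt_eqF (divr_gt0 n0 _)) ?implybT.
  by congr powR; rewrite /s; ring.
have rK : (r.+1%:R / 2) `^ s * (r.+1%:R / 2) `^ (- s) = 1 :> R.
  by rewrite -powRD ?subrr ?powRr0// (gt_eqF r0) implybT.
rewrite sqrt_m n_pow -[LHS]mulr1 -[X in _ * X = _]rK /K expr_div_n.
rewrite (_ : 4 = 2 * 2 :> R); last by rewrite -natrM.
rewrite exprMn !exprS; field.
by rewrite expf_neq0// pnatr_eq0 -lt0n fact_gt0.
Qed.
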